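(* Let $\mathcal X$ and $\Xi$ be Polish spaces and suppose Assumption A (described in the context) holds. Then: (i) If $(G_n,x^n)\to(G,x)$ in $\mathcal G_*[\mathcal X]$ as $n\to\infty$, then $P^{G_n,x^n}\to P^{G,x}$ weakly in $\mathcal P(\mathcal G_*[\mathcal X^\infty])$. (ii) For every $M\in\mathcal P(\mathcal G_*[\mathcal X])$ the measure $P[M]$ is well defined, and if $M_n\to M$ weakly in $\mathcal P(\mathcal G_*[\mathcal X])$, then $P[M_n]\to P[M]$ weakly in $\mathcal P(\mathcal G_*[\mathcal X^\infty])$.
   Context: All graphs are simple, locally finite, with finite or countably infinite vertex set; $N_v(G)$ denotes the set of neighbours of $v$ in $G$. For a metric space $(\mathcal Y,d)$, a $\mathcal Y$-marked rooted graph is a pair $(G,y)$ with $G$ a connected graph with distinguished root and $y=(y_v)_{v\in G}\in\mathcal Y^G$; two such are isomorphic if there is a bijection of vertex sets preserving root, edges and marks. $\mathcal G_*[\mathcal Y]$ is the set of isomorphism classes. For $k\in\mathbb N$, $B_k(G)$ is the induced rooted subgraph on vertices at graph distance at most $k$ from the root. $(G_n,y^n)\to(G,y)$ in $\mathcal G_*[\mathcal Y]$ means: for every $k\in\mathbb N$ and $\epsilon>0$ there is $n_k$ such that for every $n\ge n_k$ there is a (rooted graph) isomorphism $\varphi:B_k(G_n)\to B_k(G)$ with $\max_{v\in B_k(G_n)}d(y^n_v,y_{\varphi(v)})<\epsilon$; this is a metrizable topology, Polish when $\mathcal Y$ is Polish. Spaces of probability measures carry the weak topology. For a metric space $\mathcal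 Y$, $S^{\sqcup}(\mathcal Y)=\bigsqcup_{k\ge 0}S^k(\mathcal Y)$ is the space of finite unordered sequences of elements of $\mathcal Y$ of arbitrary length (possibly zero), where $S^k(\mathcal Y)$ is $\mathcal Y^k$ modulo the action of the symmetric group and $S^0(\mathcal Y)$ is a point, with the disjoint union topology; for a finite set $A$, $(z_v)_{v\in A}$ is viewed as an element of $S^\sqcup(\mathcal Y)$. $\mathcal X^\infty$ is the space of sequences $(x(k))_{k\in\mathbb N_0}$ in $\mathcal X$ with the product topology, and $x[k]=(x(0),\dots,x(k))\in\mathcal X^{k+1}$. Assumption A: (A.1) for each (possibly disconnected) graph $G$ the $\Xi$-valued noises $(\xi_v(k))_{v\in G,k\in\mathbb N}$ are i.i.d., with the same law for every $G$ (and independent of the initial data); (A.2) for each $k\in\mathbb N_0$, $F^k:\mathcal X^{k+1}\times S^\sqcup(\mathcal X^{k+1})\times\Xi\to\mathcal X$ is continuous. For a graph $G$ and $x\in\mathcal X^G$, the process $X^{G,x}=(X^{G,x}_v)_{v\in G}$ is defined by $X^{G,x}_v(0)=x_v$ and $X^{G,x}_v(k+1)=F^k\big(X^{G,x}_v[k],(X^{G,x}_u[k])_{u\in N_v(G)},\xi_v(k+1)\big)$ for $v\in G$, $k\in\mathbb N_0$. For $(G,x)\in\mathcal G_*[\mathcal X]$, $P^{G,x}\in\mathcal P(\mathcal G_*[\mathcal X^\infty])$ is the law of $(G,X^{G,x})$ (it depends only on the isomorphism class of $(G,x)$). For $M\in\mathcal P(\mathcal G_*[\mathcal X])$, $P[M]\in\mathcal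 P(\mathcal G_*[\mathcal X^\infty])$ is defined by $\int\varphi\,dP[M]=\int\langle P^{G,x},\varphi\rangle\,M(d(G,x))$ for bounded continuous $\varphi$ on $\mathcal G_*[\mathcal X^\infty]$. *)

(* Defs.v *)
From HB Require Import structures.
From mathcomp Require Import all_boot all_order all_algebra.
From mathcomp Require Import all_classical all_reals all_analysis.
From mathcomp Require Import measurable_realfun.

Set Implicit Arguments.
Unset Strict Implicit.
Unset Printing Implicit Defensive.

Import Order.TTheory GRing.Theory Num.Theory.
Import numFieldNormedType.Exports.
Local Open Scope classical_set_scope.
Local Open Scope ring_scope.

Definition separable_space (T : topologicalType) : Prop :=
  exists D : set T, countable D /\ dense D.

Definition complete_compatible_metric (R : realType) (T : topologicalType)
    (dist : T -> T -> R) : Prop :=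
  [/\ (forall x y, dist x y = 0 <-> x = y),
      (forall x y, dist x y = dist y x),
      (forall x y z, dist x z <= dist x y + dist y z),
      (forall (x : T) (A : set T),
          nbhs x A <-> exists2 e : R, 0 < e & forall y, dist x y < e -> A y) &
      (forall u : nat -> T,
          (forall e : R, 0 < e -> exists N, forall m n,
              (N <= m)%N -> (N <= n)%N -> dist (u m) (u n) < e) ->
          exists l, forall e : R, 0 < e -> exists N, forall n,
              (N <= n)%N -> dist (u n) l < e)].

Definition polish (R : realType) (T : topologicalType) : Prop :=
  separable_space T /\ exists dist : T -> T -> R, complete_compatible_metric dist.

HB.instance Definition _ (U : Type) (T : U -> ptopologicalType) :=
  Pointed.copy (prod_topology T) (forall x : U, T x).

Definition borelT (T : Type) : Type := T.

Section borel_instance.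
Variable T : ptopologicalType.
HB.instance Definition _ := PointedTopological.on (borelT T).
HB.instance Definition _ := @isMeasurable.Build (sigma_display (@open T))
  (borelT T) <<s @open T >> (@sigma_algebra0 _ setT (@open T))
  (@sigma_algebraC _ (@open T)) (@sigma_algebra_bigcup _ setT (@open T)).
End borel_instance.

(* A simple, locally finite graph on (a subset of) nat, given by adjacency
   lists; the rooted graph is the connected component of the root. *)
Record rooted_graph := RGraph {
  rg_root : nat;
  rg_nbrs : nat -> seq nat;
  rg_sym : forall u v, (u \in rg_nbrs v) = (v \in rg_nbrs u);
  rg_irr : forall v, v \notin rg_nbrs v;
  rg_uniq : forall v, uniq (rg_nbrs v)
}.

Definition rg_adj (G : rooted_graph) : rel nat := fun u v => v \in rg_nbrs G u.

Definition in_ball (G : rooted_graph) (k v : nat) : Prop :=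
  exists p : seq nat, [/\ (size p <= k)%N, path (rg_adj G) (rg_root G) p
                        & last (rg_root G) p = v].

Definition rg_vertex (G : rooted_graph) (v : nat) : Prop := exists k, in_ball G k v.

Definition ball_iso (G H : rooted_graph) (k : nat) (f g : nat -> nat) : Prop :=
  [/\ f (rg_root G) = rg_root H,
      (forall v, in_ball G k v -> in_ball H k (f v) /\ g (f v) = v),
      (forall w, in_ball H k w -> in_ball G k (g w) /\ f (g w) = w) &
      (forall u v, in_ball G k u -> in_ball G k v ->
                   rg_adj G u v = rg_adj H (f u) (f v))].

(* marked rooted graphs (representatives of G_*[Y]) *)
Definition mgraph (Y : Type) : Type := (rooted_graph * (nat -> Y))%type.

Definition mg_conv (Y : topologicalType) (Gs : nat -> mgraph Y) (G : mgraph Y)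
  : Prop :=
  forall (k : nat) (U : nat -> set Y),
    (forall v, in_ball G.1 k v -> nbhs (G.2 v) (U v)) ->
    exists nk, forall n, (nk <= n)%N ->
      exists f g, ball_iso (Gs n).1 G.1 k f g /\
        (forall v, in_ball (Gs n).1 k v -> U (f v) ((Gs n).2 v)).

(* the (metrizable) topology of G_*[Y]: the sequential topology of mg_conv *)
Definition mg_open (Y : topologicalType) (A : set (mgraph Y)) : Prop :=
  forall Gs G, mg_conv Gs G -> A G ->
    exists N, forall n, (N <= n)%N -> A (Gs n).

Section mgraph_instances.
Variable Y : ptopologicalType.

HB.instance Definition _ := gen_eqMixin (mgraph Y).
HB.instance Definition _ := gen_choiceMixin (mgraph Y).

Definition rgraph0 : rooted_graph.
Proof.
by apply: (@RGraph 0 (fun _ => [::])).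
Defined.

HB.instance Definition _ := isPointed.Build (mgraph Y)
  (rgraph0, fun _ => point).

Lemma mg_openT : mg_open [set: mgraph Y].
Proof. by move=> Gs G _ _; exists 0%N. Qed.

Lemma mg_openI : setI_closed (@mg_open Y).
Proof.
move=> A B oA oB Gs G cG [AG BG].
have [N1 H1] := oA Gs G cG AG; have [N2 H2] := oB Gs G cG BG.
exists (maxn N1 N2) => n; rewrite geq_max => /andP[h1 h2].
by split; [apply: H1|apply: H2].
Qed.

Lemma mg_open_bigU (I : Type) (f : I -> set (mgraph Y)) :
  (forall i, mg_open (f i)) -> mg_open (\bigcup_i f i).
Proof.
move=> hO Gs G cG [i _ fiG]; have [N HN] := hO i Gs G cG fiG.
by exists N => n /HN h; exists i.
Qed.

HB.instance Definition _ := isOpenTopological.Build (mgraph Y)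
  mg_openT mg_openI mg_open_bigU.
End mgraph_instances.

Definition bounded_real_fun (T : Type) (R : realType) (phi : T -> R) : Prop :=
  exists C : R, forall t, `|phi t| <= C.

Definition weak_cvg (R : realType) (T : ptopologicalType)
    (Ms : nat -> probability (borelT T) R) (M : probability (borelT T) R)
  : Prop :=
  forall phi : T -> R, continuous phi -> bounded_real_fun phi ->
    (fun n => (\int[Ms n]_x (phi x)%:E)%E) @ \oo --> (\int[M]_x (phi x)%:E)%E.

Definition iid_noise (R : realType) (d : measure_display) (Om : measurableType d)
    (P : probability Om R) (Xi : ptopologicalType) (V : set nat)
    (xi : nat -> nat -> Om -> Xi) (mu : probability (borelT Xi) R) : Prop :=
  (forall v k, V v -> (0 < k)%N ->
     measurable_fun setT (xi v k : Om -> borelT Xi)) /\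
  (forall (s : seq (nat * nat)) (A : nat * nat -> set (borelT Xi)),
     uniq s -> (forall p, p \in s -> V p.1 /\ (0 < p.2)%N) ->
     (forall p, measurable (A p)) ->
     P (\bigcap_(p in [set p | p \in s]) (xi p.1 p.2 @^-1` A p)) =
     (\prod_(p <- s) mu (A p))%E).

(* the update maps F^k : X^{k+1} x S^sqcup(X^{k+1}) x Xi -> X, an element
   of S^sqcup being represented by a finite sequence *)
Definition update_maps (X Xi : topologicalType) : Type :=
  forall k : nat, {ptws 'I_k.+1 -> X} -> seq {ptws 'I_k.+1 -> X} -> Xi -> X.

(* Assumption (A.2): F^k does not depend on the order of the sequence and is
   continuous on each X^{k+1} x S^m(X^{k+1}) x Xi (equivalently, its lift to
   X^{k+1} x (X^{k+1})^m x Xi is continuous) *)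
Definition update_ok (X Xi : topologicalType) (F : update_maps X Xi) : Prop :=
  (forall k a s s' c, perm_eq s s' -> F k a s c = F k a s' c) /\
  (forall k m : nat,
     continuous (fun p : {ptws 'I_k.+1 -> X} * {ptws 'I_m -> {ptws 'I_k.+1 -> X}}
                         * Xi =>
        F k p.1.1 [seq p.1.2 i | i <- enum 'I_m] p.2)).

(* traj F G x e k v j = X^{G,x}_v(j) for j <= k, computed with noise
   realisation e v j = xi_v(j) *)
Fixpoint traj (X Xi : topologicalType) (F : update_maps X Xi) (G : rooted_graph)
    (x : nat -> X) (e : nat -> nat -> Xi) (k : nat) : nat -> nat -> X :=
  match k with
  | 0 => fun v _ => x v
  | k'.+1 => fun v j =>
      let t := traj F G x e k' in
      let hist := fun u => (fun i : 'I_k'.+1 => t u i) : {ptws 'I_k'.+1 -> X} in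
      if (j <= k')%N then t v j
      else F k' (hist v) [seq hist u | u <- rg_nbrs G v] (e v k'.+1)
  end.

Definition process (X Xi : topologicalType) (F : update_maps X Xi) (G : rooted_graph)
    (x : nat -> X) (e : nat -> nat -> Xi) : nat -> {ptws nat -> X} :=
  fun v => (fun j : nat => traj F G x e j v j) : {ptws nat -> X}.

(* <P^{G,x}, phi> = E[phi(G, X^{G,x})], computed on the noise space of G *)
Definition law_int (R : realType) (d : measure_display)
    (Om : rooted_graph -> measurableType d) (P : forall G, probability (Om G) R)
    (X Xi : ptopologicalType) (xi : forall G, nat -> nat -> Om G -> Xi)
    (F : update_maps X Xi) (Gx : mgraph X)
    (phi : mgraph {ptws nat -> X} -> R) : \bar R :=
  (\int[P Gx.1]_w
    (phi ((Gx.1, process F Gx.1 Gx.2 (fun v k => xi Gx.1 v k w))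
           : mgraph {ptws nat -> X}))%:E)%E.

Definition is_annealed_law (R : realType) (d : measure_display)
    (Om : rooted_graph -> measurableType d) (P : forall G, probability (Om G) R)
    (X Xi : ptopologicalType) (xi : forall G, nat -> nat -> Om G -> Xi)
    (F : update_maps X Xi) (M : probability (borelT (mgraph X)) R)
    (Q : probability (borelT (mgraph {ptws nat -> X})) R) : Prop :=
  forall phi : mgraph {ptws nat -> X} -> R, continuous phi -> bounded_real_fun phi ->
    (\int[Q]_y (phi y)%:E =
     \int[M]_Gx law_int P xi F Gx phi)%E.

(* Main.v *)
(** The noises of the infinite path graph, whose vertex set is all of nat, can be
    relabelled along any injection, so they may drive the dynamics on every graph
    simultaneously without changing the laws.  If (G_n, x^n) converges to (G, x),
    a diagonal argument gives partial isomorphisms that eventually cover every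
    ball; letting matched vertices share their noise, X^{G_n,x^n} converges to
    X^{G,x} locally for every noise realisation, by continuity of the F^k, and
    (i) follows from dominated convergence.  Equality of the laws under
    relabelling is obtained by rounding the noises to the nearest point of a
    finite part of a dense sequence, which reduces it to finite sums.

    Hence the quenched laws depend continuously on (G, x).  The indicator of an
    open set is a pointwise limit of bounded continuous functions, built from the
    distance to its complement, so the quenched laws form a kernel, and P[M] is
    its mixture under M; the same approximation gives uniqueness of P[M]. *)

Require Import Defs.
From HB Require Import structures.
From mathcomp Require Import all_boot all_order all_algebra.
From mathcomp Require Import all_classical all_reals all_analysis.
From mathcomp Require Import measurable_realfun lra giry.
Import Order.TTheory GRing.Theory Num.Theory.
Import numFieldNormedType.Exports.
Local Open Scope classical_set_scope.
Local Open Scope ring_scope.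
Set Implicit Arguments.
Unset Strict Implicit.

(** * Finite balls and their rooted isomorphisms *)

Section balls.
Implicit Types (G H K : rooted_graph) (k l u v w : nat) (f g : nat -> nat).

Lemma in_ball_root G k : in_ball G k (rg_root G).
Proof. by exists [::]. Qed.

Lemma in_ball_le G k l v : (k <= l)%N -> in_ball G k v -> in_ball G l v.
Proof. by move=> kl [p [sp pp lp]]; exists p; split => //; exact: leq_trans kl. Qed.

Lemma in_ball_step G k u v : in_ball G k u -> rg_adj G u v -> in_ball G k.+1 v.
Proof.
move=> [p [sp pp lp]] uv; exists (rcons p v); split.
- by rewrite size_rcons.
- by rewrite rcons_path pp lp.
- by rewrite last_rcons.
Qed.

Lemma in_ball_path G k p : (size p <= k)%N -> path (rg_adj G) (rg_root G) p ->
  forall v, v \in rg_root G :: p -> in_ball G k v.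
Proof.
move=> sp pp v; rewrite inE => /orP[/eqP ->|vp]; first exact: in_ball_root.
case/splitPr: vp sp pp => p1 p2; rewrite size_cat cat_path /= => sp.
move=> /and3P[pp1 vp _]; exists (rcons p1 v); split.
- by rewrite size_rcons; apply: leq_trans sp; rewrite addnS ltnS leq_addr.
- by rewrite rcons_path pp1.
- by rewrite last_rcons.
Qed.

(** Local finiteness: enlarging the radius by one adds only neighbours of the finitely many vertices
    below the previous bound. Finiteness of balls later turns pointwise thresholds into uniform
    ones. *)
Lemma in_ball_bounded G k : exists b, forall v, in_ball G k v -> (v < b)%N.
Proof.
elim: k => [|k [b hb]].
  exists (rg_root G).+1 => v [p [+ _ <-]].
  by rewrite leqn0 size_eq0 => /eqP ->.
exists (maxn (maxn b (rg_root G).+1) (\max_(u < b) \max_(w <- rg_nbrs G u) w.+1)).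
move=> v [p]; case: (lastP p) => [|q w] [].
  by move=> _ _ <- /=; rewrite !leq_max leqnn orbT.
rewrite size_rcons rcons_path last_rcons ltnS => sq /andP[pq qw] <-.
have bq : (last (rg_root G) q < b)%N by apply: hb; exists q.
rewrite leq_max; apply/orP; right.
apply: leq_trans (leq_bigmax (Ordinal bq)) => /=.
by rewrite (big_rem w) //= leq_max leqnn.
Qed.

Lemma ball_isoC G H k f g : ball_iso G H k f g -> ball_iso H G k g f.
Proof.
move=> [fr fb gb fadj]; split => //.
- by rewrite -fr; case: (fb _ (in_ball_root G k)).
- move=> u v /gb[gu fgu] /gb[gv fgv].
  by rewrite fadj // fgu fgv.
Qed.

(** A path of at most [l <= k] edges from the root never leaves the ball of radius [k], so [f]
    carries it edge by edge. *)
Lemma ball_iso_in_ball G H k l f g v : (l <= k)%N -> ball_iso G H k f g ->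
  in_ball G l v -> in_ball H l (f v).
Proof.
move=> lk [fr fb gb fadj] [p [sp pp <-]]; exists (map f p).
rewrite size_map -fr last_map; split=> //.
rewrite path_map; have bp : all (fun u => `[<in_ball G k u>]) (rg_root G :: p).
  apply/allP => u hu; apply/asboolP.
  exact: (in_ball_path (leq_trans sp lk) pp hu).
rewrite -(@eq_in_path _ _ (rg_adj G) _ _ _ _ bp) // => u w /asboolP bu /asboolP bw.
by rewrite /= fadj.
Qed.

Lemma ball_iso_le G H k l f g : (l <= k)%N -> ball_iso G H k f g ->
  ball_iso G H l f g.
Proof.
move=> lk fg; have gf := ball_isoC fg.
have [fr fb gb fadj] := fg; split => //.
- move=> v lv; split; first exact: ball_iso_in_ball lk fg lv.
  by have [] := fb _ (in_ball_le lk lv).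
- move=> v lv; split; first exact: ball_iso_in_ball lk gf lv.
  by have [] := gb _ (in_ball_le lk lv).
- by move=> u v lu lv; apply: fadj; apply: in_ball_le lk _.
Qed.

Lemma ball_iso_comp G H K k f g f' g' : ball_iso G H k f g ->
  ball_iso H K k f' g' -> ball_iso G K k (f' \o f) (g \o g').
Proof.
move=> [fr fb gb fadj] [fr' fb' gb' fadj']; split => /=.
- by rewrite fr.
- by move=> v /fb[/fb'[bfv gfv] gv]; rewrite gfv.
- by move=> v /gb'[/gb[bfv gfv] gv]; rewrite gfv.
- move=> u v bu bv; rewrite fadj // fadj' //.
    by have [] := fb _ bu.
  by have [] := fb _ bv.
Qed.

(** The extra unit of radius keeps every neighbour of [v] inside the domain of the isomorphism. Only
    a permutation can be expected, since adjacency lists come in arbitrary order; the symmetry of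
    the updates absorbs it. *)
Lemma ball_iso_nbrs G H k f g v : ball_iso G H k.+1 f g -> in_ball H k v ->
  perm_eq (rg_nbrs G (g v)) (map g (rg_nbrs H v)).
Proof.
move=> fg bv; have [fr fb gb fadj] := fg.
have [_ _ _ gadj] := ball_isoC fg.
have bv' := in_ball_le (leqnSn k) bv.
have bgv : in_ball G k (g v).
  exact: ball_iso_in_ball (leqnSn k) (ball_isoC fg) bv.
have nb u : u \in rg_nbrs H v -> in_ball H k.+1 u.
  by move=> uv; apply: in_ball_step bv uv.
apply: uniq_perm; first exact: rg_uniq.
  rewrite map_inj_in_uniq ?rg_uniq // => u w /nb/gb[_ fu] /nb/gb[_ fw] guw.
  by rewrite -fu guw fw.
move=> u; apply/idP/mapP => [uv|[w wv ->]].
  have bu : in_ball G k.+1 u by apply: in_ball_step bgv uv.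
  exists (f u); last by have [] := fb _ bu.
  have [bfu gfu] := fb _ bu.
  by rewrite -[_ \in _]/(rg_adj H v (f u)) gadj // gfu.
by rewrite -[_ \in _]/(rg_adj G (g v) (g w)) -gadj //; exact: nb.
Qed.

End balls.

(** * Pointwise limits and diagonal selection *)

Section sequential_limits.

Lemma cvg_ptws (I S : Type) (T : topologicalType) (F : set_system S)
    {FF : Filter F} (u : S -> {ptws I -> T}) (f : {ptws I -> T}) :
  (forall i, (u s) i @[s --> F] --> f i) -> u @ F --> f.
Proof.
move=> uf; apply/cvg_sup => i A.
rewrite nbhsE => -[B [[C oC <-] fC] CA].
have h := open_nbhs_nbhs (conj oC fC).
have /= h2 : F [set s | C (u s i)] := uf i _ h.
exact: (@filterS _ F FF _ (u @^-1` A) (fun s us => CA (u s) us) h2).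
Qed.

Lemma cvg_eventually (T : topologicalType) (u : nat -> T) (l : T) :
  u @ \oo --> l <->
  forall A, nbhs l A -> exists N, forall n, (N <= n)%N -> A (u n).
Proof.
split=> [ul A /ul[N _ h]|ul A /ul[N h]]; first by exists N => n; exact: h.
by exists N => // n; exact: h.
Qed.

Definition first_countable (T : topologicalType) := forall x : T,
  exists B : nat -> set T, [/\ forall k, nbhs x (B k),
    forall k, B k.+1 `<=` B k & forall A, nbhs x A -> exists k, B k `<=` A].

(** For each [n], pick a [t] that meets every attainable stage [k <= n]; the cut at [n] matters
    because the attainable stages may be unbounded. A fixed [k] is then met as soon as it is
    attainable and [n >= k]. *)
Lemma diagonal_choice (T : Type) (t0 : T) (Q : nat -> nat -> T -> Prop) :
  (forall n k t, Q n k.+1 t -> Q n k t) ->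
  (forall k, exists N, forall n, (N <= n)%N -> exists t, Q n k t) ->
  exists t, forall k, exists N, forall n, (N <= n)%N -> Q n k (t n).
Proof.
move=> Qdec Qex.
have Qle n k l t : (k <= l)%N -> Q n l t -> Q n k t.
  by move=> /subnK <-; elim: (l - k)%N => // i IH; rewrite addSn => /Qdec.
have best n m : exists t, forall k, (k <= m)%N -> (exists t', Q n k t') -> Q n k t.
  elim: m => [|m [t IH]].
    have [[t Qt]|nQ] := pselect (exists t', Q n 0 t').
      by exists t => k; rewrite leqn0 => /eqP ->.
    by exists t0 => k; rewrite leqn0 => /eqP -> /nQ.
  have [[t' Qt']|nQ] := pselect (exists t', Q n m.+1 t').
    by exists t' => k km _; exact: Qle Qt'.
  by exists t => k; rewrite leq_eqVlt => /orP[/eqP -> /nQ //|]; exact: IH.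
have [t ht] := choice (fun n => best n n).
exists t => k; have [N hN] := Qex k; exists (maxn N k) => n.
by rewrite geq_max => /andP[Nn kn]; apply: ht => //; exact: hN.
Qed.

End sequential_limits.

(** * Local convergence through a single sequence of vertex maps *)

Section graph_convergence.
Implicit Types (Gs : nat -> rooted_graph) (G : rooted_graph).
Implicit Types (f g : nat -> nat -> nat).

(** Unlike in [mg_conv], the maps [f n], [g n] do not depend on the radius, so vertices can be
    followed along the sequence. *)
Definition locally_iso Gs G f g :=
  forall k, exists N, forall n, (N <= n)%N -> ball_iso (Gs n) G k (f n) (g n).

Lemma locally_iso_cst G : locally_iso (fun=> G) G (fun=> id) (fun=> id).
Proof. by move=> k; exists 0%N. Qed.

(** Diagonal choice applied to pairs of maps: stage [k] asks for an isomorphism of the balls of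
    radius [k] whose marks fall in the [k]-th basic neighbourhoods of the limit marks. *)
Lemma mg_conv_locally_iso (Y : topologicalType) (Gs : nat -> mgraph Y)
    (G : mgraph Y) :
  first_countable Y -> mg_conv Gs G ->
  exists f g, locally_iso (fun n => (Gs n).1) G.1 f g /\
    forall v, rg_vertex G.1 v -> (Gs n).2 (g n v) @[n --> \oo] --> G.2 v.
Proof.
move=> fcY GsG.
have [B hB] := choice (fun v => fcY (G.2 v)).
pose Q n k (fg : (nat -> nat) * (nat -> nat)) :=
  ball_iso (Gs n).1 G.1 k fg.1 fg.2 /\
  forall v, in_ball (Gs n).1 k v -> B (fg.1 v) k ((Gs n).2 v).
have [||fg hfg] := @diagonal_choice _ (id, id) Q.
- move=> n k [f g] [/= fgk fgB]; split; first exact: ball_iso_le fgk.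
  move=> v bv; have [_ Bdec _] := hB (f v); apply: Bdec.
  by apply: fgB; exact: in_ball_le bv.
- move=> k; have [|N hN] := GsG k (fun v => B v k).
    by move=> v _; have [] := hB v.
  by exists N => n /hN[f [g fg]]; exists (f, g).
exists (fun n => (fg n).1), (fun n => (fg n).2); split.
  by move=> k; have [N hN] := hfg k; exists N => n /hN[].
move=> v [l bv]; apply/cvg_eventually => A.
have [_ Bdec /[apply] -[k BA]] := hB v.
have [N hN] := hfg (maxn k l); exists N => n /hN[isoh fgB].
have [_ _ gb _] := isoh.
have [bg fgv] := gb v (in_ball_le (leq_maxr _ _) bv).
apply: BA; have := fgB _ bg; rewrite fgv.
have : (k <= maxn k l)%N by exact: leq_maxl.
by move=> /subnK <-; elim: (_ - k)%N => // i IH; rewrite addSn => /Bdec.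
Qed.

(** The ball is finite, so the convergence thresholds of its marks have a maximum. *)
Lemma locally_iso_mg_conv (Y : topologicalType) (Gs : nat -> mgraph Y) G y f g :
  locally_iso (fun n => (Gs n).1) G f g ->
  (forall v, rg_vertex G v -> (Gs n).2 (g n v) @[n --> \oo] --> y v) ->
  mg_conv Gs (G, y).
Proof.
move=> fg cvy k U yU.
have [b hb] := in_ball_bounded G k.
have [N1 hN1] := fg k.
have /choice[N hN] w : exists Nw, in_ball G k w ->
    forall n, (Nw <= n)%N -> U w ((Gs n).2 (g n w)).
  have [bw|nbw] := pselect (in_ball G k w); last by exists 0%N => /nbw.
  have /cvg_eventually/(_ _ (yU w bw))[Nw hNw] := cvy w (ex_intro _ k bw).
  by exists Nw => _.
exists (maxn N1 (\max_(w < b) N w)) => n; rewrite geq_max => /andP[/hN1 isoh Nn].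
exists (f n), (g n); split => // v bv.
have [_ fb _ _] := isoh; have [bfv gfv] := fb v bv.
rewrite -{2}gfv; apply: hN => //; apply: leq_trans Nn.
exact: (leq_bigmax (Ordinal (hb _ bfv))).
Qed.

End graph_convergence.

(** * Continuity of the dynamics for a fixed noise realisation *)

Section process_convergence.
Variables (X Xi : topologicalType) (F : update_maps X Xi).
Arguments F k _ _ _ : clear implicits.

Lemma traj_process G x e k v j : (j <= k)%N ->
  traj F G x e k v j = process F G x e v j.
Proof.
elim: k => [|k IH]; first by rewrite leqn0 => /eqP ->.
by rewrite leq_eqVlt => /orP[/eqP -> //|]; rewrite ltnS /= => jk; rewrite jk IH.
Qed.

Definition past (y : nat -> {ptws nat -> X}) k u : {ptws 'I_k.+1 -> X} :=
  fun i => y u i.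
Arguments past y k u : clear implicits.

Lemma processS G x e v k : process F G x e v k.+1 =
  F k (past (process F G x e) k v)
    [seq past (process F G x e) k u | u <- rg_nbrs G v] (e v k.+1).
Proof.
rewrite /process /= ltnn.
have h u : (fun i : 'I_k.+1 => traj F G x e k u i) = past (process F G x e) k u.
  by apply/funext => i; apply: traj_process; rewrite -ltnS.
by rewrite h; congr (F k _ _ _); apply: eq_map => u; exact: h.
Qed.

Hypothesis FA : update_ok F.

(** Continuity of the update is assumed for each fixed number of neighbours, so the list over [s] is
    rewritten as a table indexed by ['I_(size s)]. *)
Lemma update_cvg k (s : seq nat) (a : nat -> {ptws 'I_k.+1 -> X})
    (a' : {ptws 'I_k.+1 -> X}) (b : nat -> nat -> {ptws 'I_k.+1 -> X})
    (b' : nat -> {ptws 'I_k.+1 -> X}) (c : nat -> Xi) c' :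
  a @ \oo --> a' -> (forall u, u \in s -> b n u @[n --> \oo] --> b' u) ->
  c @ \oo --> c' ->
  F k (a n) [seq b n u | u <- s] (c n) @[n --> \oo] -->
  F k a' [seq b' u | u <- s] c'.
Proof.
move=> aa bb cc; have [_ /(_ k (size s))] := FA.
set Phi := (X in continuous X) => cPhi.
pose tab (h : nat -> {ptws 'I_k.+1 -> X}) :
  {ptws 'I_(size s) -> {ptws 'I_k.+1 -> X}} := fun i => h (nth 0%N s i).
have tabE h : [seq h u | u <- s] = [seq tab h i | i <- enum 'I_(size s)].
  by rewrite -[in LHS](mkseq_nth 0%N s) /mkseq -map_comp -val_enum_ord -map_comp.
have PhiE n : F k (a n) [seq b n u | u <- s] (c n) = Phi (a n, tab (b n), c n).
  by rewrite tabE.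
rewrite (_ : F k a' _ c' = Phi (a', tab b', c')) /Phi /=; last by rewrite tabE.
under eq_fun do rewrite PhiE.
apply: (@cvg_comp _ _ _ (fun n => (a n, tab (b n), c n)) Phi).
  have tb : tab (b n) @[n --> \oo] --> tab b'.
    by apply: cvg_ptws => i; apply: bb; rewrite mem_nth.
  exact: (cvg_pair (cvg_pair aa tb) cc).
by have := cPhi (a', tab b', c').
Qed.

(** Induction on time: the state at time [k.+1] depends on the pasts of [v] and of its neighbours up
    to time [k], all of which converge. *)
Lemma process_cvg Gs G x x' e e' f g : locally_iso Gs G f g ->
  (forall v, rg_vertex G v -> x n (g n v) @[n --> \oo] --> x' v) ->
  (forall v j, rg_vertex G v -> (0 < j)%N ->
     e n (g n v) j @[n --> \oo] --> e' v j) ->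
  forall v, rg_vertex G v ->
  process F (Gs n) (x n) (e n) (g n v) @[n --> \oo] --> process F G x' e' v.
Proof.
move=> fg cx ce.
suff main k v j : (j <= k)%N -> rg_vertex G v ->
    process F (Gs n) (x n) (e n) (g n v) j @[n --> \oo] --> process F G x' e' v j.
  by move=> v vG; apply: cvg_ptws => j; exact: main vG.
elim: k v j => [|k IH] v j; first by rewrite leqn0 => /eqP -> /cx.
rewrite leq_eqVlt => /orP[/eqP -> {j}|]; last exact: IH.
move=> vG; rewrite processS.
have pastcv u : rg_vertex G u ->
    past (process F (Gs n) (x n) (e n)) k (g n u) @[n --> \oo] -->
    past (process F G x' e') k u.
  by move=> uG; apply: cvg_ptws => i; apply: IH => //; rewrite -ltnS.
have [l bv] := vG.
have nbG u : u \in rg_nbrs G v -> rg_vertex G u.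
  by move=> uv; exists l.+1; exact: in_ball_step bv uv.
have := @update_cvg k (rg_nbrs G v) _ _
  (fun n u => past (process F (Gs n) (x n) (e n)) k (g n u)) _ _ _
  (pastcv v vG) (fun u uv => pastcv u (nbG u uv)) (ce v k.+1 vG isT).
apply: cvg_trans; apply: near_eq_cvg.
(* Radius [l.+1] contains the neighbours of [v]; once the balls of this radius match, the list of
   [g n v] is a permutation of the image of the list of [v], and the update does not see the
   order. *)
have [N hN] := fg l.+1; exists N => // n /= /hN isoh.
have [Fperm _] := FA.
rewrite processS; apply: Fperm; rewrite perm_sym.
have := perm_map (past (process F (Gs n) (x n) (e n)) k) (ball_iso_nbrs isoh bv).
by rewrite -map_comp.
Qed.

Lemma process_mg_conv Gs G x x' e e' f g : locally_iso Gs G f g ->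
  (forall v, rg_vertex G v -> x n (g n v) @[n --> \oo] --> x' v) ->
  (forall v j, rg_vertex G v -> (0 < j)%N ->
     e n (g n v) j @[n --> \oo] --> e' v j) ->
  mg_conv (fun n => (Gs n, process F (Gs n) (x n) (e n)))
    (G, process F G x' e').
Proof.
move=> fg cx ce.
apply: (@locally_iso_mg_conv _ (fun n => (Gs n, process F (Gs n) (x n) (e n)))
  _ _ _ _ fg) => v vG /=.
exact: process_cvg vG.
Qed.

End process_convergence.

(** * Sequential nature of the topology on marked graphs *)

Section mgraph_topology.

Lemma mg_openE (Y : ptopologicalType) : open = @mg_open Y.
Proof. by []. Qed.

Lemma mg_conv_continuous (Y : ptopologicalType) (T : topologicalType)
    (phi : mgraph Y -> T) : continuous phi ->
  forall Gs G, mg_conv Gs G -> phi (Gs n) @[n --> \oo] --> phi G.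
Proof.
move=> /continuousP cphi Gs G GsG; apply/cvg_eventually => A.
rewrite nbhsE => -[B [oB phiB] BA].
have := cphi _ oB; rewrite mg_openE => /(_ _ _ GsG phiB)[N hN].
by exists N => n /hN/BA.
Qed.

Lemma continuous_mg_conv (Y : ptopologicalType) (T : topologicalType)
    (phi : mgraph Y -> T) :
  (forall Gs G, mg_conv Gs G -> phi (Gs n) @[n --> \oo] --> phi G) ->
  continuous phi.
Proof.
move=> cphi; apply/continuousP => A oA; rewrite mg_openE => Gs G.
move=> /cphi/cvg_eventually h AG.
by apply: h; apply: open_nbhs_nbhs.
Qed.

End mgraph_topology.

(** * Gauges on trajectories and on marked graphs *)

Section gauges.
Variable R : realType.

(* A quantitative form of a metrizable uniformity: [N r x y] plays the role of
   "x and y are at distance less than r". *)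
Definition is_gauge (Y : topologicalType) (N : R -> Y -> Y -> Prop) :=
  [/\ forall r y, 0 < r -> N r y y,
      forall r y z, N r y z -> N r z y,
      forall r s x y z, 0 < r -> 0 < s -> N r x y -> N s y z -> N (r + s) x z,
      forall r s y z, 0 < r -> r <= s -> N r y z -> N s y z &
      forall y A, nbhs y A <-> exists2 r, 0 < r & forall z, N r y z -> A z].

Lemma dist_gauge (Y : topologicalType) (dist : Y -> Y -> R) :
  complete_compatible_metric dist -> is_gauge (fun r y z => dist y z < r).
Proof.
move=> [d0 dC dtri dnbhs _]; split => //.
- by move=> r y r0; rewrite (d0 y y).2.
- by move=> r y z; rewrite dC.
- by move=> r s x y z _ _ xy yz; apply: le_lt_trans (dtri x y z) _; exact: ltrD.
- by move=> r s y z _ rs yz; exact: lt_le_trans rs.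
Qed.

Lemma exists_invn_lt (r : R) : 0 < r ->
  exists n, forall m, (n <= m)%N -> m.+1%:R^-1 < r.
Proof.
move=> r0; have [n rn] : exists n, r^-1 < n%:R.
  by exists (Num.truncn r^-1).+1; exact: truncnS_gt.
exists n => m nm; rewrite invf_plt ?posrE ?ltr0n//.
by apply: lt_le_trans rn _; rewrite ler_nat leqW.
Qed.

Lemma gauge_first_countable (Y : topologicalType) (N : R -> Y -> Y -> Prop) :
  is_gauge N -> first_countable Y.
Proof.
move=> [_ _ _ Nle Nnbhs] y; exists (fun k z => N k.+1%:R^-1 y z); split.
- by move=> k; apply/Nnbhs; exists k.+1%:R^-1 => //; rewrite invr_gt0 ltr0n.
- move=> k z; apply: Nle; rewrite ?invr_gt0 ?ltr0n//.
  by rewrite lef_pV2 ?posrE ?ltr0n// ler_nat.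
- move=> A /Nnbhs[r r0 NA]; have [n hn] := exists_invn_lt r0.
  exists n => z Nz; apply: NA; apply: Nle Nz; first by rewrite invr_gt0 ltr0n.
  exact/ltW/hn.
Qed.

(** For [r > 0]: tolerance [r] on the coordinates [j < 1/r], stated without division. This gives a
    gauge for the product topology on sequences. *)
Definition ptws_gauge_rel (Y : Type) (N : R -> Y -> Y -> Prop) r (y z : nat -> Y) :=
  forall j : nat, j%:R * r < 1 -> N r (y j) (z j).

Lemma natmul_lt1_le (j : nat) (r s : R) : r <= s -> j%:R * s < 1 -> j%:R * r < 1.
Proof. by move=> rs; apply: le_lt_trans; rewrite ler_wpM2l. Qed.

Lemma natmul_lt1_nat (r : R) : 0 < r ->
  exists m, forall j : nat, j%:R * r < 1 -> (j < m)%N.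
Proof.
move=> r0; have rm := truncnS_gt r^-1.
exists (Num.truncn r^-1).+1 => j; rewrite -ltr_pdivlMr// div1r => jr.
by rewrite -(ltr_nat R); exact: lt_trans rm.
Qed.

Lemma natmul_invn_lt1 (i n : nat) : (i <= n)%N -> i%:R * n.+1%:R^-1 < 1 :> R.
Proof. by move=> i_n; rewrite ltr_pdivrMr ?ltr0n// mul1r ltr_nat ltnS. Qed.

Lemma ptws_gauge (Y : topologicalType) (N : R -> Y -> Y -> Prop) :
  is_gauge N -> is_gauge (ptws_gauge_rel N : _ -> {ptws nat -> Y} -> _ -> _).
Proof.
move=> [Nrefl Nsym Ntri Nle Nnbhs]; split.
- by move=> r y r0 j _; exact: Nrefl.
- by move=> r y z yz j /yz; exact: Nsym.
- move=> r s x y z r0 s0 xy yz j jrs; apply: Ntri => //.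
    by apply: xy; apply: natmul_lt1_le jrs; rewrite lerDl ltW.
  by apply: yz; apply: natmul_lt1_le jrs; rewrite lerDr ltW.
- move=> r s y z r0 rs yz j js; apply: (Nle r) => //; apply: yz.
  exact: natmul_lt1_le js.
- move=> y A; split=> [yA|[r r0 NA]].
    (* If no radius works, some [z n] lies outside [A] within gauge [1/(n+1)] of [y]; these points
       converge coordinatewise to [y], against [A] being a neighbourhood. *)
    apply: contrapT => nr.
    have /choice[z hz] n : exists z, ptws_gauge_rel N n.+1%:R^-1 y z /\ ~ A z.
      apply: contrapT => nz; apply: nr; exists n.+1%:R^-1.
        by rewrite invr_gt0 ltr0n.
      by move=> z yz; apply: contrapT => nAz; apply: nz; exists z.
    have zy : (z : nat -> {ptws nat -> Y}) @ \oo --> (y : {ptws nat -> Y}).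
      apply: cvg_ptws => i; apply/cvg_eventually => B /Nnbhs[r r0 NB].
      have [n hn] := exists_invn_lt r0; exists (maxn n i) => m.
      rewrite geq_max => /andP[/hn/ltW mr im]; apply: NB.
      apply: Nle mr _; first by rewrite invr_gt0 ltr0n.
      by apply: (hz m).1; exact: natmul_invn_lt1.
    have /cvg_eventually/(_ A yA)[n hn] := zy.
    by have [_] := hz n; apply; exact: hn.
  (* Only the coordinates below [m] are constrained at radius [r], and finitely many such
     constraints define a neighbourhood. *)
  have [m hm] := natmul_lt1_nat r0.
  have FF : Filter (nbhs (y : {ptws nat -> Y})) := @nbhs_filter {ptws nat -> Y} y.
  suff : nbhs (y : {ptws nat -> Y}) [set z | forall j, (j < m)%N -> N r (y j) (z j)].
    by apply: filterS => z yz; apply: NA => j /hm; exact: yz.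
  elim: m {hm} => [|m IH]; first by apply: filterS filterT => z.
  have Nm : nbhs (y m) (N r (y m)) by apply/Nnbhs; exists r.
  have := @proj_continuous nat (fun=> Y) m y _ Nm.
  move=> /(filterI IH); apply: filterS => z [/= zm zNm] j.
  by rewrite ltnS leq_eqVlt => /orP[/eqP ->|/zm].
Qed.

Section mgraph_gauge.
Variables (Y : ptopologicalType) (N : R -> Y -> Y -> Prop).
Hypothesis gN : is_gauge N.

(** The local metric in gauge form: for [r > 0], the balls of every radius [k < 1/r] must match with
    tolerance [r] on the marks. *)
Definition close r (G H : mgraph Y) := forall k : nat, k%:R * r < 1 ->
  exists f g, ball_iso G.1 H.1 k f g /\
    forall v, in_ball G.1 k v -> N r (G.2 v) (H.2 (f v)).

Lemma close_refl r G : 0 < r -> close r G G.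
Proof.
have [Nrefl _ _ _ _] := gN.
by move=> r0 k _; exists id, id; split => // v _; exact: Nrefl.
Qed.

Lemma close_sym r G H : close r G H -> close r H G.
Proof.
have [_ Nsym _ _ _] := gN.
move=> GH k /GH[f [g [fg fN]]]; exists g, f; split; first exact: ball_isoC.
move=> v bv; have [_ _ gb _] := fg; have [bgv fgv] := gb v bv.
by have /Nsym := fN _ bgv; rewrite fgv.
Qed.

Lemma close_trans r s G H K : 0 < r -> 0 < s ->
  close r G H -> close s H K -> close (r + s) G K.
Proof.
have [_ _ Ntri _ _] := gN.
move=> r0 s0 GH HK k krs.
have [|f [g [fg fN]]] := GH k.
  by apply: natmul_lt1_le krs; rewrite lerDl ltW.
have [|f' [g' [fg' fN']]] := HK k.
  by apply: natmul_lt1_le krs; rewrite lerDr ltW.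
exists (f' \o f), (g \o g'); split; first exact: ball_iso_comp fg'.
move=> v bv; apply: Ntri (fN v bv) _ => //; apply: fN'.
by have [_ fb _ _] := fg; have [] := fb v bv.
Qed.

Lemma close_le r s G H : 0 < r -> r <= s -> close r G H -> close s G H.
Proof.
have [_ _ _ Nle _] := gN.
move=> r0 rs GH k ks; have [|f [g [fg fN]]] := GH k.
  exact: natmul_lt1_le ks.
by exists f, g; split => // v /fN; exact: Nle.
Qed.

Lemma mg_conv_close Gs G r : mg_conv Gs G -> 0 < r ->
  exists n0, forall n, (n0 <= n)%N -> close r (Gs n) G.
Proof.
have [_ Nsym _ _ Nnbhs] := gN.
move=> GsG r0; have [m hm] := natmul_lt1_nat r0.
have [|n0 hn0] := GsG m (fun v => N r (G.2 v)).
  by move=> v _; apply/Nnbhs; exists r.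
exists n0 => n /hn0[f [g [fg fN]]] k /hm/ltnW km; exists f, g; split.
  exact: ball_iso_le fg.
by move=> v bv; apply: Nsym; apply: fN; exact: in_ball_le bv.
Qed.

Lemma close_mg_conv Gs G :
  (forall r, 0 < r -> exists n0, forall n, (n0 <= n)%N -> close r (Gs n) G) ->
  mg_conv Gs G.
Proof.
have [_ Nsym _ Nle Nnbhs] := gN.
move=> GsG k U GU; have [b hb] := in_ball_bounded G.1 k.
have [r r0 hr] : exists2 r, 0 < r & forall v, (v < b)%N -> in_ball G.1 k v ->
    forall z, N r (G.2 v) z -> U v z.
  elim: b {hb} => [|b [r r0 IH]]; first by exists 1.
  have [/GU/Nnbhs[s s0 sU]|nb] := pselect (in_ball G.1 k b).
    exists (Num.min r s); first by rewrite lt_min r0.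
    move=> v; rewrite ltnS leq_eqVlt => /orP[/eqP ->|vb] bv z.
      by move=> /Nle Nz; apply: sU; apply: Nz; rewrite ?lt_min ?r0// ge_min lexx orbT.
    by move=> /Nle Nz; apply: IH => //; apply: Nz; rewrite ?lt_min ?r0// ge_min lexx.
  by exists r => // v; rewrite ltnS leq_eqVlt => /orP[/eqP -> /nb//|]; exact: IH.
(* The second term forces [k * s < 1], so that closeness at [s] does test the ball of radius [k]. *)
pose s := Num.min r k.+1%:R^-1.
have s0 : 0 < s by rewrite lt_min r0 invr_gt0 ltr0n.
have [n0 hn0] := GsG s s0; exists n0 => n /hn0/(_ k)[|f [g [fg fN]]].
  apply: (@natmul_lt1_le _ _ k.+1%:R^-1); last exact: natmul_invn_lt1.
  by rewrite ge_min lexx orbT.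
exists f, g; split => // v bv; have [_ fb _ _] := fg; have [bfv _] := fb v bv.
apply: hr (hb _ bfv) bfv _ _; apply: (Nle s); rewrite ?ge_min ?lexx//.
exact/Nsym/fN.
Qed.

Section distance_to_complement.
Variable U : set (mgraph Y).

Let radii G := [set r : R | 0 < r /\ (1 <= r \/ exists2 H, ~ U H & close r G H)].

(* Distance (truncated at 1) from [G] to the complement of [U]. *)
Let gap G := inf (radii G).

Let radii1 G : radii G 1. Proof. by split => //; left. Qed.

Let radii_lb G : lbound (radii G) 0. Proof. by move=> r [/ltW]. Qed.

Let gap_le G r : radii G r -> gap G <= r.
Proof. by move=> Gr; apply: ge_inf => //; exists 0; exact: radii_lb. Qed.

Let gap_ge0 G : 0 <= gap G.
Proof. by apply: lb_le_inf; [exists 1; exact: radii1|exact: radii_lb]. Qed.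

(** Triangle inequality: a complement point within [r] of [H] is within [r + s] of [G]. Used in both
    directions it makes [gap] continuous. *)
Let gap_close s G H : 0 < s -> close s G H -> gap G <= gap H + s.
Proof.
move=> s0 GH; rewrite -lerBlDr; apply: lb_le_inf; first by exists 1.
move=> r [r0 hr]; rewrite lerBlDr; apply: gap_le; split; first exact: addr_gt0.
case: hr => [r1|[K nUK HK]]; first by left; rewrite (le_trans r1)// lerDl ltW.
by right; exists K => //; rewrite addrC; exact: close_trans HK.
Qed.

Let gap_continuous : continuous gap.
Proof.
apply: continuous_mg_conv => Gs G GsG; apply/cvgrPdist_le => e e0.
have [n0 hn0] := mg_conv_close GsG e0; exists n0 => // n /= /hn0 GnG.
rewrite ler_distlC lerBlDr; apply/andP; split; apply: gap_close => //.
exact: close_sym.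
Qed.

Lemma open_positivity_set : open U -> exists phi : mgraph Y -> R,
  [/\ continuous phi, forall G, 0 <= phi G <= 1 & forall G, U G <-> 0 < phi G].
Proof.
rewrite mg_openE => oU; exists gap; split => // [G|G].
  by rewrite gap_ge0 gap_le.
split=> [UG|gapG]; last first.
  (* A [G] outside [U] is its own witness at every positive radius, in particular at half of its
     positive gap. *)
  apply: contrapT => nUG; have : gap G <= gap G / 2.
    apply: gap_le; split; first by rewrite divr_gt0.
    by right; exists G => //; apply: close_refl; rewrite divr_gt0.
  by rewrite leNgt ltr_pdivrMr// ltr_pMr// ltr1n.
rewrite lt_neqAle gap_ge0 andbT; apply/eqP => gap0.
(* Zero gap at a point of [U] produces graphs outside [U] converging to it, which the sequential
   definition of openness forbids. *)
have /choice[H hH] n : exists H, ~ U H /\ close n.+1%:R^-1 G H.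
  have n0 : 0 < n.+1%:R^-1 :> R by rewrite invr_gt0 ltr0n.
  have [|r [r0 hr] rn] := @inf_adherent _ (radii G) n.+1%:R^-1 n0.
    by split; [exists 1; exact: radii1|exists 0; exact: radii_lb].
  rewrite -/(gap G) -gap0 add0r in rn.
  case: hr => [r1|[H nUH GH]].
    suff : r < 1 by rewrite ltNge r1.
    by rewrite (lt_le_trans rn)// invf_le1 ?ltr0n// ler1n.
  by exists H; split => //; exact: close_le (ltW rn) GH.
have HG : mg_conv H G.
  apply: close_mg_conv => r r0; have [n0 hn0] := exists_invn_lt r0.
  exists n0 => n /hn0/ltW nr; apply: close_sym.
  by apply: close_le nr (hH n).2; rewrite invr_gt0 ltr0n.
have [n0 /(_ n0 (leqnn _)) UHn] := oU _ _ HG UG.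
by have [] := hH n0.
Qed.

End distance_to_complement.
End mgraph_gauge.
End gauges.

(** * Integrals of bounded and of finitely valued functions *)

Section bounded_convergence.
Context d (T : measurableType d) (R : realType) (P : probability T R).

Lemma bounded_integrable (f : T -> R) : measurable_fun setT f ->
  bounded_real_fun f -> P.-integrable setT (EFin \o f).
Proof.
move=> mf [C fC]; apply: (@le_integrable _ _ _ _ _ _ _ (EFin \o cst C)) => //.
- exact/measurable_EFinP.
- by move=> x _; rewrite /= lee_fin (le_trans (fC x))// ler_norm.
- exact: finite_measure_integrable_cst.
Qed.

Lemma integral_addcst (f : T -> \bar R) (C : R) : P.-integrable setT f ->
  (\int[P]_x (f x + C%:E) = \int[P]_x f x + C%:E)%E.
Proof.
move=> intf; have iC := finite_measure_integrable_cst P C measurableT.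
rewrite (integralD measurableT intf iC); congr (_ + _)%E.
transitivity (C%:E * P setT)%E; first exact: (@integral_cst _ _ _ P setT measurableT C%:E).
by rewrite probability_setT mule1.
Qed.

Lemma bounded_cvg (f_ : nat -> T -> R) (f : T -> R) (C : R) :
  (forall n, measurable_fun setT (f_ n)) -> (forall n x, `|f_ n x| <= C) ->
  (forall x, f_ n x @[n --> \oo] --> f x) ->
  (\int[P]_x (f_ n x)%:E @[n --> \oo] --> \int[P]_x (f x)%:E)%E.
Proof.
move=> mf_ f_C ff.
have mf : measurable_fun setT f by apply: measurable_fun_cvg mf_ _ => x _.
have [] // := @dominated_convergence _ _ _ P _ measurableT
  (fun n x => (f_ n x)%:E) (fun x => (f x)%:E) (EFin \o cst C).
- by move=> n; exact/measurable_EFinP.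
- exact/measurable_EFinP.
- by apply: aeW => x _; apply: cvg_EFin; [exact: nearW|exact: ff].
- exact: finite_measure_integrable_cst.
- by apply: aeW => x n _; rewrite lee_fin.
Qed.

Lemma finite_valued_measurable (I : finType) (q : T -> I) (k : I -> R) :
  (forall i, measurable [set x | q x = i]) -> measurable_fun setT (k \o q).
Proof.
move=> mq _ B _; rewrite setTI.
rewrite (_ : _ @^-1` B = \bigcup_(i in [set i | B (k i)]) [set x | q x = i]).
  by apply: fin_bigcup_measurable => // i _; exact: mq.
by apply/seteqP; split=> [x Bx|x [i /[swap] <-]//]; exists (q x).
Qed.

Lemma finite_valued_integral (I : finType) (q : T -> I) (k : I -> R) :
  (forall i, measurable [set x | q x = i]) ->
  (\int[P]_x (k (q x))%:E = \sum_(i : I) (k i)%:E * P [set x | q x = i])%E.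
Proof.
move=> mq.
transitivity (\int[P]_x (\sum_(i : I) (k i)%:E * (\1_[set x | q x = i] x)%:E))%E.
  apply: eq_integral => x _; rewrite (bigD1 (q x))//= indicE mem_set// mule1.
  rewrite big1 ?adde0// => i iqx; rewrite indicE memNset ?mule0//= => qi.
  by rewrite qi eqxx in iqx.
rewrite integral_sum//; last first.
  by move=> i; apply: integrableZl => //; exact: integrable_indic.
apply: eq_bigr => i _; rewrite integralZl//; last exact: integrable_indic.
by rewrite integral_indic// setIT.
Qed.

End bounded_convergence.

(** * Rounding to a finite part of a dense sequence *)

Section nearest_point.
Context (R : realType) (X : ptopologicalType) (dist : X -> X -> R).
Hypothesis dist_ok : complete_compatible_metric dist.

Lemma separable_dense_seq : separable_space X ->
  exists p : nat -> X, forall x r, 0 < r -> exists n, dist x (p n) < r.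
Proof.
move=> [D [/countable_injP[e einj] denseD]].
(* The injection of [D] into the naturals is inverted by [xget]; indices outside its image fall back
   on [point]. *)
exists (fun n => xget point [set x | D x /\ e x = n]) => x r r0.
have [_ _ _ _ Nnbhs] := dist_gauge dist_ok.
have /nbhs_interior xr : nbhs x [set y | dist x y < r] by apply/Nnbhs; exists r.
have [||y [yr Dy]] := denseD ([set y | dist x y < r]^°).
- by exists x; exact: nbhs_singleton xr.
- exact: open_interior.
exists (e y); case: xgetP => [z _ [Dz ez]|/(_ y)[]//].
by rewrite (einj z y) ?inE//; exact: interior_subset yr.
Qed.

Variable p : nat -> X.

(** The candidates are [p 0, ..., p m], and ties keep the smaller index, so each step is decided by
    one strict, hence open, comparison. *)
Fixpoint nearest m x := match m with
  | 0 => 0%N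
  | m'.+1 => if dist x (p m'.+1) < dist x (p (nearest m' x))
             then m'.+1 else nearest m' x
  end.

Lemma nearest_le m x : (nearest m x <= m)%N.
Proof. by elim: m => //= m IH; case: ifP => // _; exact: leqW. Qed.

Lemma nearest_min m x n : (n <= m)%N -> dist x (p (nearest m x)) <= dist x (p n).
Proof.
elim: m => [|m IH]; first by rewrite leqn0 => /eqP ->.
rewrite leq_eqVlt => /orP[/eqP ->|]; last rewrite ltnS => /IH nm.
  by rewrite /=; case: ifPn => //; rewrite -leNgt.
by rewrite /=; case: ifP => // /ltW h; exact: le_trans nm.
Qed.

Lemma nearest_cvg x : (forall r, 0 < r -> exists n, dist x (p n) < r) ->
  p (nearest m x) @[m --> \oo] --> x.
Proof.
move=> xp; have [_ _ _ _ Nnbhs] := dist_gauge dist_ok.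
apply/cvg_eventually => A /Nnbhs[r r0 rA]; have [n xn] := xp r r0.
by exists n => m nm; apply: rA; exact: le_lt_trans (nearest_min _ nm) xn.
Qed.

Lemma open_closer a b : open [set x | dist x a < dist x b].
Proof.
have [_ dC dtri dnbhs _] := dist_ok.
rewrite openE => x /= ab; apply/dnbhs.
(* Moving [x] by less than half the margin changes each of the two distances by less than that half,
   so the strict order survives. *)
exists ((dist x b - dist x a) / 2); first by rewrite divr_gt0// subr_gt0.
move=> y xy /=; have := dtri y x a; have := dtri x y b; rewrite (dC y x).
by move: xy; rewrite ltr_pdivlMr// mulr_natr mulr2n; lra.
Qed.

Lemma nearest_measurable m i :
  measurable [set x : borelT X | nearest m x = i].
Proof.
have mcloser a b : measurable [set x : borelT X | dist x a < dist x b].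
  by apply: sub_sigma_algebra; exact: open_closer.
elim: m i => [|m IH] i /=.
  have [->|i0] := eqVneq i 0%N.
    by rewrite (_ : [set _ | _] = setT)//; apply/seteqP.
  rewrite (_ : [set _ | _] = set0)//; apply/seteqP; split => // x /= /esym/eqP.
  by rewrite (negbTE i0).
pose closer j := [set x : borelT X | dist x (p m.+1) < dist x (p j)].
(* Split according to the previous nearest index [j]; then [i] is either the new index [m.+1], if it
   is closer, or [j] itself. *)
rewrite (_ : [set _ | _] = \bigcup_j ([set x | nearest m x = j] `&`
  ((if i == m.+1 then closer j else set0) `|`
   (if i == j then ~` closer j else set0)))).
  apply: bigcup_measurable => j _; apply: measurableI => //.
  apply: measurableU; case: ifP => // _; first exact: mcloser.
  by apply: measurableC; exact: mcloser.
apply/seteqP; split=> [x /=|x [j _ [/= <-]]].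
  case: ifPn => [c <-|c <-]; exists (nearest m x) => //; split => //.
    by left; rewrite eqxx.
  by right; rewrite eqxx; exact/negP.
move=> []; case: eqP => // ->; first by rewrite /closer/= => ->.
by move=> /negP/negbTE ->.
Qed.

End nearest_point.

(** * Expectations of noise functionals depend only on the noise law *)

Section noise_law.
Context (R : realType) (Xi : ptopologicalType) (mu : probability (borelT Xi) R).
Variables (V : set nat) (h : (nat -> nat -> Xi) -> R).
Hypothesis polishXi : polish R Xi.
Hypothesis hV : forall en e, (forall v j, V v -> (0 < j)%N ->
  en n v j @[n --> \oo] --> e v j) -> h (en n) @[n --> \oo] --> h e.
Hypothesis h_bounded : bounded_real_fun h.

Section discretization.
Variables (dist : Xi -> Xi -> R) (p : nat -> Xi).
Hypothesis dist_ok : complete_compatible_metric dist.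
Hypothesis p_dense : forall x r, 0 < r -> exists n, dist x (p n) < r.

Definition code_type m : finType := {ffun 'I_m.+1 * 'I_m.+1 -> 'I_m.+1}.

Definition noisy (i : nat * nat) := `[< V i.1 >] && (0 < i.2)%N.

(** Sites without noise are frozen at [ord0], so the code is governed by finitely many i.i.d.
    variables. Nothing is lost for [h]: by [hV], convergence at the noisy sites alone suffices. *)
Definition code m (e : nat -> nat -> Xi) : code_type m :=
  [ffun i : 'I_m.+1 * 'I_m.+1 => if noisy (val i.1, val i.2)
    then inord (nearest dist p m (e i.1 i.2)) else ord0].

(** Outside the grid [inord] returns the default index 0; a given site is inside the grid as soon as
    [m] is large. *)
Definition decode m (a : code_type m) (v j : nat) : Xi :=
  p (a (inord v, inord j)).

Lemma decode_code_cvg e v j : V v -> (0 < j)%N ->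
  decode (code m e) v j @[m --> \oo] --> e v j.
Proof.
move=> Vv j0.
apply: cvg_trans (nearest_cvg dist_ok (p_dense (e v j))).
apply: near_eq_cvg; exists (maxn v j) => // m /=; rewrite geq_max => /andP[vm jm].
rewrite /decode /code ffunE /= !inordK ?ltnS// /noisy /= asboolT//= j0.
by rewrite inordK// ltnS nearest_le.
Qed.

Definition sites m :=
  [seq i <- allpairs pair (iota 0 m.+1) (iota 0 m.+1) | noisy i].

Definition cell m (a : code_type m) (i : nat * nat) : set (borelT Xi) :=
  [set c | nearest dist p m c = a (inord i.1, inord i.2)].

Lemma mem_sites m i : (i \in sites m) =
  [&& noisy i, (i.1 <= m)%N & (i.2 <= m)%N].
Proof.
case: i => v j; rewrite mem_filter; congr (_ && _).
apply/allpairsP/andP => [[[a b] []]|[vm jm]].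
  by rewrite !mem_iota => + + [-> ->].
by exists (v, j); rewrite !mem_iota.
Qed.

Lemma sites_uniq m : uniq (sites m).
Proof.
rewrite filter_uniq// allpairs_uniq ?iota_uniq// => -[? ?] [? ?] _ _.
by case=> -> ->.
Qed.

Lemma cell_measurable m (a : code_type m) i : measurable (cell a i).
Proof. exact: nearest_measurable. Qed.

(* Codes vanish at the sites that carry no noise. *)
Definition admissible m (a : code_type m) :=
  [forall i, ~~ noisy (val i.1, val i.2) ==> (a i == ord0)].

Definition code_weight m (a : code_type m) : \bar R :=
  if admissible a then (\prod_(i <- sites m) mu (cell a i))%E else 0%E.

Section iid.
Context d (Om : measurableType d) (P : probability Om R).
Variable xi : nat -> nat -> Om -> Xi.
Hypothesis iid : iid_noise P V xi mu.

Lemma noisyP i : noisy i -> V i.1 /\ (0 < i.2)%N.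
Proof. by move=> /andP[/asboolP]. Qed.

(** A code fixes the cell of each noisy site of the grid and nothing else, which is the form of
    event to which independence applies. *)
Lemma code_event m (a : code_type m) :
  [set w | code m (fun v j => xi v j w) = a] =
  if admissible a then
    \bigcap_(i in [set i | i \in sites m]) (xi i.1 i.2 @^-1` cell a i)
  else set0.
Proof.
case: ifPn => [/forallP/= adm|/negP nadm]; apply/seteqP; split=> w //=.
- move=> <- [v j] /=; rewrite mem_sites => /and3P[nvj vm jm].
  rewrite /cell /code /= ffunE /= !inordK ?ltnS ?nearest_le// nvj inordK//.
  by rewrite ltnS nearest_le.
- move=> wa; apply/ffunP => -[v j]; rewrite ffunE.
  case: ifPn => [nvj|nvj]; last first.
    by have /implyP/(_ nvj)/eqP := adm (v, j).
  have /= := wa (val v, val j); rewrite /cell /= !inord_val => ->.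
    by rewrite inord_val.
  by rewrite mem_sites nvj /= !leq_ord.
- move=> wa; apply: nadm; rewrite -wa; apply/forallP => -[v j]; apply/implyP.
  by rewrite ffunE => /negbTE ->.
Qed.

Lemma code_event_measurable m (a : code_type m) :
  measurable [set w | code m (fun v j => xi v j w) = a].
Proof.
rewrite code_event; case: ifP => // _; apply: fin_bigcap_measurable.
  exact: finite_seq.
move=> i /=; rewrite mem_sites => /andP[/noisyP[Vi i0] _].
by rewrite -[X in measurable X]setTI; apply: iid.1 => //; exact: cell_measurable.
Qed.

Lemma code_event_prob m (a : code_type m) :
  P [set w | code m (fun v j => xi v j w) = a] = code_weight a.
Proof.
rewrite code_event /code_weight; case: ifP => // _.
apply: iid.2; first exact: sites_uniq.
  by move=> i; rewrite mem_sites => /andP[/noisyP].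
by move=> i; exact: cell_measurable.
Qed.

Let approx m w := h (decode (code m (fun v j => xi v j w))).

Let approx_cvg w : approx m w @[m --> \oo] --> h (fun v j => xi v j w).
Proof. by apply: hV => v j Vv j0; exact: decode_code_cvg. Qed.

Let approx_measurable m : measurable_fun setT (approx m).
Proof.
apply: (@finite_valued_measurable _ _ _ _ _ (fun a => h (@decode m a))).
exact: code_event_measurable.
Qed.

Lemma noise_fun_measurable : measurable_fun setT (fun w => h (fun v j => xi v j w)).
Proof. by apply: (measurable_fun_cvg approx_measurable) => w _. Qed.

(** The finite sums involve only [h], [mu] and [V], not the probability space or [xi]. Two noises
    with the same law therefore give limits of the same sequence. *)
Lemma noise_integral_cvg :
  (\sum_(a : code_type m) (h (@decode m a))%:E * code_weight a @[m --> \oo] -->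
   \int[P]_w (h (fun v j => xi v j w))%:E)%E.
Proof.
have [C hC] := h_bounded.
have := bounded_cvg (P := P) approx_measurable (fun m w => hC _) approx_cvg.
apply: cvg_trans; apply: near_eq_cvg; exists 0%N => // m _ /=.
rewrite (@finite_valued_integral _ _ _ P _ _ (fun a => h (@decode m a))).
  by apply: eq_bigr => a _; rewrite code_event_prob.
exact: code_event_measurable.
Qed.

End iid.
End discretization.

Lemma iid_noise_measurable d (Om : measurableType d) (P : probability Om R) xi :
  iid_noise P V xi mu -> measurable_fun setT (fun w => h (fun v j => xi v j w)).
Proof.
have [/[swap] -[dist dist_ok] /(separable_dense_seq dist_ok)[p hp]] := polishXi.
exact: noise_fun_measurable dist_ok hp _ _ _ _.
Qed.

Lemma iid_noise_integral d (Om : measurableType d) (P : probability Om R) xi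
    d' (Om' : measurableType d') (P' : probability Om' R) xi' :
  iid_noise P V xi mu -> iid_noise P' V xi' mu ->
  (\int[P]_w (h (fun v j => xi v j w))%:E =
   \int[P']_w (h (fun v j => xi' v j w))%:E)%E.
Proof.
move=> iid iid'.
have [/[swap] -[dist dist_ok] /(separable_dense_seq dist_ok)[p hp]] := polishXi.
have c := noise_integral_cvg dist_ok hp iid.
have c' := noise_integral_cvg dist_ok hp iid'.
exact: (cvg_unique _ c c').
Qed.

End noise_law.

(** An injective relabelling sends distinct sites to distinct sites, so a product formula over [I]
    is one over the image of [I]. *)
Lemma iid_noise_relabel (R : realType) d (Om : measurableType d)
    (P : probability Om R) (Xi : ptopologicalType) (V W : set nat) xi
    (mu : probability (borelT Xi) R) (s : nat -> nat) :
  (forall v, V v -> W (s v)) -> {in V &, injective s} ->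
  iid_noise P W xi mu -> iid_noise P V (xi \o s) mu.
Proof.
move=> sVW sinj [mxi prod_xi]; split=> [v k /sVW|I A uI VI mA]; first exact: mxi.
pose s2 (i : nat * nat) := (s i.1, i.2).
have s2inj : {in I &, injective s2}.
  move=> [v j] [v' j'] /VI[/= Vv _] /VI[/= Vv' _] [+ ->].
  by move=> /sinj ->//; rewrite inE.
(* The events carried over to the image sites: the preimage of [i] is searched for in [I], with
   [set0] as a measurable default off the image. *)
pose A' (i : nat * nat) :=
  if has (fun j => s2 j == i) I
  then A (nth (0%N, 0%N) I (find (fun j => s2 j == i) I)) else set0.
have A'E i : i \in I -> A' (s2 i) = A i.
  move=> iI; rewrite /A'; have hI : has (fun j => s2 j == s2 i) I.
    by apply/hasP; exists i.
  rewrite hI; congr A; apply: s2inj => //.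
    by rewrite mem_nth// -has_find.
  by have /eqP := nth_find (0%N, 0%N) hI.
transitivity (\prod_(i <- map s2 I) mu (A' i))%E; last first.
  by rewrite big_map; apply: eq_big_seq => i /A'E ->.
rewrite -prod_xi.
- congr (P _); apply/seteqP; split=> w Aw i /=.
    by move=> /mapP[j jI ->]; rewrite A'E//; exact: Aw.
  by move=> iI; have := Aw (s2 i) (map_f s2 iI); rewrite /= A'E.
- by rewrite map_inj_in_uniq.
- by move=> i /mapP[j /VI[Vj j0] ->]; split => //; exact: sVW.
- by move=> i; rewrite /A'; case: ifP.
Qed.

(** * Borel measures on marked graphs and continuous test functions *)

Section borel_mgraph.
Context (R : realType).

Lemma continuous_borel_measurable (T : ptopologicalType) (phi : T -> R) :
  continuous phi -> measurable_fun setT (phi : borelT T -> R).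
Proof.
move=> /continuousP cphi; apply: (measurability _ (RGenOpens.measurableE R)).
move=> _ [B oB <-]; rewrite setTI.
have {oB} oB : open B.
  by case: oB => x [y] ->; exact: interval_open.
by apply: sub_sigma_algebra; exact: cphi.
Qed.

Lemma bounded_integral_le d (T : measurableType d) (P : probability T R)
    (f : T -> R) C : measurable_fun setT f -> (forall t, `|f t| <= C) ->
  (`|\int[P]_t (f t)%:E| <= C%:E)%E.
Proof.
move=> mf fC; have mEf : measurable_fun setT (EFin \o f) by exact/measurable_EFinP.
apply: le_trans (le_abse_integral _ measurableT mEf) _.
have <- : (C%:E * P setT)%E = C%:E by rewrite probability_setT mule1.
apply: integral_le_bound => //; last by apply: aeW => t _; rewrite lee_fin.
by rewrite lee_fin (le_trans _ (fC point)).
Qed.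

Variables (Y : ptopologicalType) (N : R -> Y -> Y -> Prop).
Hypothesis gN : is_gauge N.

(** With [phi] positive exactly on [U], the functions [1 - (1 - phi) ^+ n] tend to 1 on [U] and
    vanish off it. *)
Lemma open_indic_approx (U : set (mgraph Y)) : open U ->
  exists phi : nat -> mgraph Y -> R, [/\ forall n, continuous (phi n),
    forall n G, 0 <= phi n G <= 1 &
    forall G, phi n G @[n --> \oo] --> (\1_U G : R)].
Proof.
move=> /(open_positivity_set gN)[phi [cphi phi01 Uphi]].
have psi01 G : 0 <= 1 - phi G <= 1.
  by have /andP[? ?] := phi01 G; rewrite subr_ge0 lerBlDr lerDl; apply/andP.
exists (fun n G => 1 - (1 - phi G) ^+ n); split.
- move=> n G.
  have psiG : 1 - phi H @[H --> G] --> 1 - phi G.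
    by apply: (cvgB (cvg_cst (1 : R)) (cphi G)).
  have psinG : (1 - phi H) ^+ n @[H --> G] --> (1 - phi G) ^+ n.
    exact: (cvg_comp _ _ psiG (@exprn_continuous R n _)).
  exact: (cvgB (cvg_cst (1 : R)) psinG).
- move=> n G; have /andP[h0 h1] := psi01 G.
  by rewrite subr_ge0 exprn_ile1//= lerBlDr lerDl exprn_ge0.
- move=> G; rewrite indicE; have [UG|nUG] := pselect (U G).
    have psi0 : (1 - phi G) ^+ n @[n --> \oo] --> 0.
      apply: cvg_expr; have /andP[h0 h1] := psi01 G.
      by rewrite ger0_norm// ltrBlDr ltrDl; exact/Uphi.
    rewrite mem_set// -[X in _ --> X]subr0.
    exact: (cvgB (cvg_cst (1 : R)) psi0).
  rewrite memNset//; have phi0 : phi G = 0.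
    apply/eqP; rewrite eq_le (andP (phi01 G)).1 andbT leNgt.
    by apply/negP => /Uphi.
  rewrite phi0 subr0; under eq_fun do rewrite expr1n subrr.
  exact: cvg_cst.
Qed.

(** Approximating indicators gives agreement on open sets, which are stable under intersection and
    generate the Borel sets. *)
Lemma probability_mgraph_unique (Q Q' : probability (borelT (mgraph Y)) R) :
  (forall phi : mgraph Y -> R, continuous phi -> bounded_real_fun phi ->
     \int[Q]_y (phi y)%:E = \int[Q']_y (phi y)%:E)%E ->
  forall A, measurable A -> Q A = Q' A.
Proof.
move=> QQ'; have openQ (U : set (mgraph Y)) : open U -> Q U = Q' U.
  move=> oU; have mU : measurable (U : set (borelT (mgraph Y))).
    exact: sub_sigma_algebra.
  have [phi [cphi phi01 phiU]] := open_indic_approx oU.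
  have phi1 n G : `|phi n G| <= 1.
    by have /andP[h0 h1] := phi01 n G; rewrite ger0_norm.
  have lim (P : probability (borelT (mgraph Y)) R) :
      (\int[P]_y (phi n y)%:E @[n --> \oo] --> P U)%E.
    have <- : (\int[P]_y (\1_U y)%:E)%E = P U.
      by rewrite (integral_indic _ measurableT mU) setIT.
    apply: (bounded_cvg (C := 1)) => // n.
    exact: continuous_borel_measurable.
  have eQ : (fun n => \int[Q]_y (phi n y)%:E)%E =
      (fun n => \int[Q']_y (phi n y)%:E)%E.
    by apply/funext => n; apply: QQ' => //; exists 1.
  have limQ := lim Q; rewrite eQ in limQ.
  exact: (cvg_unique _ limQ (lim Q')).
apply: (@measure_unique _ R (borelT (mgraph Y)) open (fun=> setT)) => //.
- exact: openI.
- by move=> _; exact: openT.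
- by apply/seteqP; split => // x _; exists 0%N.
- by move=> _; exact: le_lt_trans (probability_le1 Q measurableT) (ltry _).
Qed.

End borel_mgraph.

(** * Probabilities from elements of the Giry monad of mass one *)

Section probability_of_giry.
Context d (T : measurableType d) (R : realType) (Q : giry T R).
Hypothesis Q1 : Q setT = 1%E.

Definition giry_probability of Q setT = 1%E : set T -> \bar R := Q.

Let Q_ := giry_probability Q1.

HB.instance Definition _ := isMeasure.Build _ _ _ Q_ (measure0 Q)
  (measure_ge0 Q) (@measure_semi_sigma_additive _ _ _ Q).
HB.instance Definition _ := Measure_isProbability.Build _ _ _ Q_ Q1.

Lemma giry_is_probability : exists P : probability T R, P = Q :> (set T -> \bar R).
Proof. by exists Q_. Qed.

End probability_of_giry.

(** * The infinite path and coupling labels *)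

Section path_graph.

Definition path_nbrs v := if v is u.+1 then [:: u; u.+2] else [:: 1%N].

Lemma path_nbrsE u v : (u \in path_nbrs v) = (u == v.+1) || (v == u.+1).
Proof. by case: v => [|v]; rewrite !inE ?orbF// eqSS orbC eq_sym [v == u]eq_sym. Qed.

Definition path_graph : rooted_graph.
Proof.
apply: (@RGraph 0 path_nbrs) => [u v|v|v].
- by rewrite !path_nbrsE orbC.
- by rewrite path_nbrsE orbb -addn1 -[X in X == _]addn0 eqn_add2l.
- by case: v => //= v; rewrite inE andbT -addn2 -[X in X == _]addn0 eqn_add2l.
Defined.

Lemma path_graph_vertex v : rg_vertex path_graph v.
Proof.
exists v; elim: v => [|v IH]; first exact: in_ball_root.
by apply: in_ball_step IH _; rewrite /rg_adj /= path_nbrsE eqxx.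
Qed.

End path_graph.

(** A matched vertex is recovered from its even label by halving and applying [g], an unmatched one
    from its odd label; parity separates the two kinds. *)
Lemma injective_odd_even (V : set nat) (f g : nat -> nat) :
  {in V &, injective (fun v => if g (f v) == v then (f v).*2 else v.*2.+1)}.
Proof.
move=> v w _ _ /=; case: eqP => [gv|_]; case: eqP => [gw|_].
- by move=> /double_inj fvw; rewrite -gv fvw gw.
- by move=> /(congr1 odd); rewrite /= !odd_double.
- by move=> /(congr1 odd); rewrite /= !odd_double.
- by move=> /succn_inj/double_inj.
Qed.

(** * Quenched laws and their continuity *)

Section particle_systems.
Context (R : realType) (X Xi : ptopologicalType) (d : measure_display)
  (Om : rooted_graph -> measurableType d)
  (P : forall G : rooted_graph, probability (Om G) R)
  (xi : forall G : rooted_graph, nat -> nat -> Om G -> Xi)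
  (mu : probability (borelT Xi) R) (F : update_maps X Xi).
Arguments xi : clear implicits.
Hypothesis polishX : polish R X.
Hypothesis polishXi : polish R Xi.
Hypothesis iid : forall G : rooted_graph, iid_noise (P G) (rg_vertex G) (xi G) mu.
Hypothesis FA : update_ok F.

Notation Y := {ptws nat -> X}.

Let gauge_exists : exists N : R -> Y -> Y -> Prop, is_gauge N.
Proof.
have [_ [dist /dist_gauge gdist]] := polishX.
by exists (ptws_gauge_rel (fun r y z => dist y z < r)); exact: ptws_gauge.
Qed.

Let X_first_countable : first_countable X.
Proof.
have [_ [dist /dist_gauge gdist]] := polishX.
exact: gauge_first_countable gdist.
Qed.

Let G0 := path_graph.

(* The noise on the infinite path serves all graphs at once, since every
   natural number is a vertex of it. *)
Definition common_noise (s : nat -> nat) (w : Om G0) : nat -> nat -> Xi :=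
  fun v j => xi G0 (s v) j w.

Lemma iid_common_noise (V : set nat) s : {in V &, injective s} ->
  iid_noise (P G0) V (xi G0 \o s) mu.
Proof.
move=> sinj; apply: iid_noise_relabel sinj (iid G0) => v _.
exact: path_graph_vertex.
Qed.

Section observable.
Variables (phi : mgraph Y -> R).
Hypotheses (cphi : continuous phi) (bphi : bounded_real_fun phi).

Definition observed (Gx : mgraph X) (e : nat -> nat -> Xi) : R :=
  phi (Gx.1, process F Gx.1 Gx.2 e).

(** Process convergence along a constant sequence of graphs. This is the continuity in the noise
    that the results on noise functionals require. *)
Lemma observed_cvg Gx en e :
  (forall v j, rg_vertex Gx.1 v -> (0 < j)%N -> en n v j @[n --> \oo] --> e v j) ->
  observed Gx (en n) @[n --> \oo] --> observed Gx e.
Proof.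
move=> ce.
have cx v : rg_vertex Gx.1 v -> Gx.2 v @[_ --> \oo] --> Gx.2 v.
  by move=> _; exact: cvg_cst.
have := @process_mg_conv _ _ F FA _ _ (fun=> Gx.2) _ en _ _ _
  (locally_iso_cst Gx.1) cx ce.
by move=> /(mg_conv_continuous cphi).
Qed.

Lemma observed_bounded Gx : bounded_real_fun (observed Gx).
Proof. by have [C hC] := bphi; exists C => e; exact: hC. Qed.

Lemma observed_measurable (Gx : mgraph X) s :
  {in (rg_vertex Gx.1 : set nat) &, injective s} ->
  measurable_fun setT (fun w => observed Gx (common_noise s w)).
Proof.
move=> /iid_common_noise iids.
exact: (iid_noise_measurable polishXi (@observed_cvg Gx) iids).
Qed.

(** Each graph comes with its own probability space; moving all expectations to the space of the
    path lets different graphs be compared pointwise. The choice of [s] is left free for the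
    coupling. *)
Lemma law_int_common (Gx : mgraph X) s :
  {in (rg_vertex Gx.1 : set nat) &, injective s} ->
  law_int P xi F Gx phi = (\int[P G0]_w (observed Gx (common_noise s w))%:E)%E.
Proof.
move=> /iid_common_noise iids.
exact: (iid_noise_integral polishXi (@observed_cvg Gx) (@observed_bounded Gx)
  (iid Gx.1) iids).
Qed.

Lemma law_int_id Gx :
  law_int P xi F Gx phi = (\int[P G0]_w (observed Gx (common_noise id w))%:E)%E.
Proof. by apply: law_int_common => v w _ _. Qed.

(* Coupling: the vertices of [Gs n] matched with a vertex [v] of [G] use the
   noise of label [2 v], all others use odd labels. *)
Lemma law_int_cvg Gs G : mg_conv Gs G ->
  law_int P xi F (Gs n) phi @[n --> \oo] --> law_int P xi F G phi.
Proof.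
move=> /(mg_conv_locally_iso X_first_countable)[f [g [fg cx]]].
pose s n v := if g n (f n v) == v then (f n v).*2 else v.*2.+1.
have sinj n : {in (rg_vertex (Gs n).1 : set nat) &, injective (s n)}.
  exact: injective_odd_even.
have dinj : {in (rg_vertex G.1 : set nat) &, injective double}.
  by move=> v w _ _; exact: double_inj.
rewrite (law_int_common dinj).
under eq_fun do rewrite (law_int_common (sinj _)).
have [C hC] := bphi.
apply: (bounded_cvg (C := C)) => [n|n w|w]; [exact: observed_measurable|exact: hC|].
suff noise_cvg v j : rg_vertex G.1 v -> (0 < j)%N ->
    common_noise (s n) w (g n v) j @[n --> \oo] --> common_noise double w v j.
  have := @process_mg_conv _ _ F FA _ _ (fun n => (Gs n).2) _
    (fun n => common_noise (s n) w) _ _ _ fg cx noise_cvg.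
  by move=> /(mg_conv_continuous cphi).
move=> [k bv] _.
(* Once the ball containing [v] is matched, [g n v] carries the label [v.*2] exactly, so its noise
   is eventually constant in [n]. *)
apply: cvg_near_cst; have [n0 hn0] := fg k; exists n0 => // n /= /hn0 isoh.
have [_ _ gb _] := isoh; have [_ fgv] := gb v bv.
by rewrite /common_noise /s fgv eqxx.
Qed.

Lemma law_int_le C : (forall y, `|phi y| <= C) ->
  forall Gx, (`|law_int P xi F Gx phi| <= C%:E)%E.
Proof.
move=> hC Gx; rewrite law_int_id; apply: bounded_integral_le => [|w]; last exact: hC.
by apply: observed_measurable => v w _ _.
Qed.

Lemma law_int_fin Gx : law_int P xi F Gx phi \is a fin_num.
Proof.
have [C hC] := bphi; rewrite fin_num_abs.
by apply: le_lt_trans (law_int_le hC Gx) _; exact: ltry.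
Qed.

Lemma fine_law_int_continuous :
  continuous (fun Gx => fine (law_int P xi F Gx phi)).
Proof.
apply: continuous_mg_conv => Gs G GsG; apply: fine_cvg.
by rewrite fineK ?law_int_fin//; exact: law_int_cvg.
Qed.

Lemma fine_law_int_bounded :
  bounded_real_fun (fun Gx => fine (law_int P xi F Gx phi)).
Proof.
have [C hC] := bphi; exists C => Gx.
by rewrite -lee_fin -abse_EFin fineK ?law_int_fin//; exact: law_int_le.
Qed.

Lemma law_int_measurable : measurable_fun setT
  (fun Gx : borelT (mgraph X) => law_int P xi F Gx phi).
Proof.
rewrite (_ : (fun _ => _) = EFin \o (fun Gx => fine (law_int P xi F Gx phi))).
  apply/measurable_EFinP; apply: continuous_borel_measurable.
  exact: fine_law_int_continuous.
by apply/funext => Gx /=; rewrite fineK ?law_int_fin.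
Qed.

End observable.

(** * The quenched laws as a probability kernel *)

Definition evolution (Gx : mgraph X) (w : Om G0) : borelT (mgraph Y) :=
  (Gx.1, process F Gx.1 Gx.2 (common_noise id w)).

(** An open set is the positivity set of a continuous [phi], so its preimage is the event that a
    measurable real observable is positive. *)
Lemma evolution_measurable Gx : measurable_fun setT (evolution Gx).
Proof.
apply: (@measurability _ _ _ (borelT (mgraph Y)) setT (evolution Gx)
  (@open (mgraph Y)) erefl) => _ [U oU <-].
rewrite setTI; have [N gN] := gauge_exists.
have [phi [cphi _ Uphi]] := open_positivity_set gN oU.
have mphi := @observed_measurable phi cphi Gx id (fun v w _ _ => id).
rewrite (_ : _ @^-1` U = setT `&`
    (fun w => observed phi Gx (common_noise id w)) @^-1` `]0, +oo[%classic).
  exact: mphi.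
by rewrite setTI; apply/seteqP; split=> w /=; rewrite in_itv/= andbT => /Uphi.
Qed.

(** The measure $P^{G,x}$ itself, realised as a push-forward from the space of the path graph. *)
Definition quenched_law (Gx : borelT (mgraph X)) : giry (borelT (mgraph Y)) R :=
  giry_map (evolution_measurable Gx) (P G0).

Lemma quenched_law_int (phi : mgraph Y -> R) C (Gx : borelT (mgraph X)) :
  continuous phi -> (forall y, `|phi y| <= C) ->
  (\int[quenched_law Gx]_y (phi y + C)%:E = law_int P xi F Gx phi + C%:E)%E.
Proof.
move=> cphi hC; rewrite (law_int_id cphi); last by exists C.
have mphiC : measurable_fun setT (fun y : borelT (mgraph Y) => (phi y + C)%:E).
  apply/measurable_EFinP; apply: measurable_funD => //.
  exact: continuous_borel_measurable.
have phiC0 y : (0 <= (phi y + C)%:E)%E.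
  by rewrite lee_fin -lerBlDr sub0r (lerNnormlW (hC y)).
have := @giry_int_map _ _ _ _ R _ (evolution_measurable Gx) (P G0) _ mphiC phiC0.
rewrite /giry_int => ->.
have mobs := @observed_measurable phi cphi Gx id (fun v w _ _ => id).
have iobs := bounded_integrable (P G0) mobs.
under eq_integral do rewrite /= EFinD.
by apply: integral_addcst; apply: iobs; exists C => w; exact: hC.
Qed.

Lemma quenched_law_setT Gx : quenched_law Gx setT = 1%E.
Proof. exact: (probability_setT (P G0)). Qed.

(** Dynkin induction from the open sets. For [U] open, the mass of [U] is the pointwise limit of the
    integrals of continuous functions approximating its indicator, which are measurable in [Gx]. *)
Lemma quenched_law_measurable : measurable_fun setT quenched_law.
Proof.
apply: measurable_giry_codensity => // B mB.
pose good := [set B : set (borelT (mgraph Y)) |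
  measurable_fun setT (fun Gx : borelT (mgraph X) => quenched_law Gx B)].
suff : good B by [].
apply: (@dynkin_induction _ (borelT (mgraph Y)) open) => //.
- exact: openI.
- rewrite /good /=; under eq_fun do rewrite quenched_law_setT.
  exact: measurable_cst.
- move=> U oU; rewrite /good /=; have [N gN] := gauge_exists.
  have [phi [cphi phi01 phiU]] := open_indic_approx gN oU.
  have phi1 n G : `|phi n G| <= 1.
    by have /andP[h0 h1] := phi01 n G; rewrite ger0_norm.
  have bphi n : bounded_real_fun (phi n) by exists 1.
  apply: (@emeasurable_fun_cvg _ (borelT (mgraph X)) R setT
    (fun n Gx => law_int P xi F Gx (phi n))) => [n|Gx _ /=].
    exact: law_int_measurable.
  under eq_fun do rewrite (law_int_id (cphi _) (bphi _)).
  have mU : measurable (evolution Gx @^-1` U).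
    rewrite -[X in measurable X]setTI; apply: evolution_measurable => //.
    exact: sub_sigma_algebra.
  have <- : (\int[P G0]_w (\1_U (evolution Gx w))%:E)%E = quenched_law Gx U.
    rewrite -[RHS]/(P G0 (evolution Gx @^-1` U)).
    by rewrite -[RHS](congr1 (P G0) (setIT _)) -(integral_indic _ measurableT mU).
  apply: (bounded_cvg (C := 1)) => [n|n w|w]; [|exact: phi1|exact: phiU].
  by apply: observed_measurable => // v w _ _.
- move=> S mS gS; rewrite /good /=.
  rewrite (_ : (fun _ => _) = fun Gx => (1 - quenched_law Gx S)%E).
    by apply: emeasurable_funB => //; exact: measurable_cst.
  apply/funext => Gx; have mS' : measurable (evolution Gx @^-1` S).
    by rewrite -[X in measurable X]setTI; exact: evolution_measurable.
  exact: (probability_setC (P G0) mS').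
- move=> S mS tS gS; rewrite /good /=.
  rewrite (_ : (fun _ => _) =
      fun Gx => (\sum_(0 <= i <oo | i \in setT) quenched_law Gx (S i))%E).
    apply: ge0_emeasurable_sum => [k Gx _ _|k _]; first exact: measure_ge0.
    exact: gS.
  apply/funext => Gx.
  exact: (@measure_bigcup _ R _ (quenched_law Gx) setT S (fun i _ => mS i) tS).
Qed.

(** * Annealed laws as mixtures of quenched laws *)

Lemma annealed_law_exists (M : probability (borelT (mgraph X)) R) :
  exists Q, is_annealed_law P xi F M Q.
Proof.
pose Qm : giry (borelT (mgraph Y)) R :=
  giry_bind (M : giry _ _) quenched_law_measurable.
have Qm1 : Qm setT = 1%E.
  transitivity (\int[M]_Gx quenched_law Gx setT)%E.
    rewrite -[LHS]/(giry_int (giry_map quenched_law_measurable (M : giry _ _))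
      (giry_ev ^~ setT)).
    by rewrite giry_int_map//; exact: measurable_giry_ev.
  under eq_integral do rewrite quenched_law_setT.
  transitivity (1 * M setT)%E; last by rewrite probability_setT mule1.
  exact: (@integral_cst _ _ _ M setT measurableT 1%E).
have [Q QE] := giry_is_probability Qm1; exists Q => phi cphi bphi.
have [C hC] := bphi.
have mphi : measurable_fun setT (phi : borelT (mgraph Y) -> R).
  exact: continuous_borel_measurable.
(* The integral formula for the mixture is applied to the nonnegative function [phi + C], with [C] a
   bound of [phi]; the finite constant is subtracted at the end. *)
have mphiC : measurable_fun setT (fun y : borelT (mgraph Y) => (phi y + C)%:E).
  by apply/measurable_EFinP; exact: measurable_funD.
have phiC0 y : (0 <= (phi y + C)%:E)%E.
  by rewrite lee_fin -lerBlDr sub0r (lerNnormlW (hC y)).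
have bindE := giry_int_bind M quenched_law_measurable mphiC phiC0.
have QC : (\int[Q]_y (phi y + C)%:E = \int[Q]_y (phi y)%:E + C%:E)%E.
  by rewrite -integral_addcst//; exact: bounded_integrable.
have MC : (\int[M]_Gx (law_int P xi F Gx phi + C%:E) =
    \int[M]_Gx law_int P xi F Gx phi + C%:E)%E.
  apply: integral_addcst.
  rewrite (_ : (fun _ => _) = EFin \o (fun Gx => fine (law_int P xi F Gx phi))).
    apply: bounded_integrable; last exact: fine_law_int_bounded.
    by apply: continuous_borel_measurable; exact: fine_law_int_continuous.
  by apply/funext => Gx /=; rewrite fineK ?law_int_fin.
have CK x : (x + C%:E - C%:E)%E = x by rewrite addeK.
rewrite -[LHS]CK -[RHS]CK -QC -MC; congr (_ - _)%E.
transitivity (giry_int Qm (fun y => (phi y + C)%:E)).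
  by rewrite /giry_int; congr (integral _ _ _).
rewrite bindE; apply: eq_integral => Gx _; exact: quenched_law_int.
Qed.

Lemma annealed_law_unique (M : probability (borelT (mgraph X)) R) Q Q' :
  is_annealed_law P xi F M Q -> is_annealed_law P xi F M Q' ->
  forall A, measurable A -> Q A = Q' A.
Proof.
have [N gN] := gauge_exists.
move=> MQ MQ'; apply: (probability_mgraph_unique gN) => phi cphi bphi.
by rewrite MQ// MQ'.
Qed.

(** The quenched expectation of [phi] is itself a bounded continuous function of the initial graph,
    hence a test function for the convergence of [Ms]. *)
Lemma annealed_law_cvg Ms M Qs Q : weak_cvg Ms M ->
  (forall n, is_annealed_law P xi F (Ms n) (Qs n)) ->
  is_annealed_law P xi F M Q -> weak_cvg Qs Q.
Proof.
move=> MsM MsQs MQ phi cphi bphi.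
have lawE (K : probability (borelT (mgraph X)) R) L : is_annealed_law P xi F K L ->
    (\int[L]_y (phi y)%:E = \int[K]_Gx (fine (law_int P xi F Gx phi))%:E)%E.
  move=> KL; rewrite KL//; apply: eq_integral => Gx _.
  by rewrite fineK ?law_int_fin.
rewrite (lawE _ _ MQ); under eq_fun do rewrite (lawE _ _ (MsQs _)).
apply: MsM; first exact: fine_law_int_continuous.
exact: fine_law_int_bounded.
Qed.

End particle_systems.

Unset Implicit Arguments.
Set Strict Implicit.

Theorem theorem3p2 (R : realType) (X Xi : ptopologicalType)
    (d : measure_display) (Om : rooted_graph -> measurableType d)
    (P : forall G : rooted_graph, probability (Om G) R)
    (xi : forall G : rooted_graph, nat -> nat -> Om G -> Xi)
    (mu : probability (borelT Xi) R) (F : update_maps X Xi) :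
  polish R X -> polish R Xi ->
  (* Assumption (A.1) *)
  (forall G : rooted_graph, iid_noise (P G) (rg_vertex G) (xi G) mu) ->
  (* Assumption (A.2) *)
  update_ok F ->
  (* (i) *)
  (forall (Gs : nat -> mgraph X) (G : mgraph X), mg_conv Gs G ->
     forall phi : mgraph {ptws nat -> X} -> R,
       continuous phi -> bounded_real_fun phi ->
       (fun n => law_int P xi F (Gs n) phi) @ \oo --> law_int P xi F G phi)
  /\
  (* (ii) P[M] is well defined ... *)
  (forall phi : mgraph {ptws nat -> X} -> R,
       continuous phi -> bounded_real_fun phi ->
       measurable_fun setT
         (fun Gx : borelT (mgraph X) => law_int P xi F Gx phi))
  /\
  (forall M : probability (borelT (mgraph X)) R,
     (exists Q, is_annealed_law P xi F M Q) /\
     (forall Q Q', is_annealed_law P xi F M Q -> is_annealed_law P xi F M Q' ->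
        forall A, measurable A -> Q A = Q' A))
  /\
  (* ... and M_n -> M weakly implies P[M_n] -> P[M] weakly *)
  (forall (Ms : nat -> probability (borelT (mgraph X)) R)
          (M : probability (borelT (mgraph X)) R)
          (Qs : nat -> probability (borelT (mgraph {ptws nat -> X})) R)
          (Q : probability (borelT (mgraph {ptws nat -> X})) R),
     weak_cvg Ms M ->
     (forall n, is_annealed_law P xi F (Ms n) (Qs n)) ->
     is_annealed_law P xi F M Q ->
     weak_cvg Qs Q).
Proof.
move=> polishX polishXi iid FA; split; last split; last split.
- by move=> Gs G GsG phi cphi bphi; exact: law_int_cvg GsG.
- by move=> phi cphi bphi; exact: law_int_measurable.
- move=> M; split; first exact: annealed_law_exists.
  by move=> Q Q'; exact: annealed_law_unique.
- by move=> Ms M Qs Q; exact: annealed_law_cvg.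
Qed.
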